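(* Let $G=(V,E)$ be a finite hypergraph with $|e|\ge 2$ for every $e\in E$, let $n=|V|$, let $\sigma=(v_1,\ldots,v_n)$ be an order of $V$, and let $i\in\{1,\ldots,n\}$. Then the set of reachable states of the compact decision diagram of $G$ under $\sigma$ after assigning the variables of $U_i=\{v_1,\ldots,v_i\}$ is in bijection with the set of valid antichains of the poset $(\mathcal{R}_i,\subseteq)$.
   Context: A hypergraph $G=(V,E)$ has finite vertex set $V$ and a set $E$ of hyperedges $e\subseteq V$ with $|e|\ge2$. Fix a vertex order $\sigma=(v_1,\ldots,v_n)$, $n=|V|$. Put $U_0=\emptyset$ and $U_i=\{v_1,\ldots,v_i\}$. The set of active hyperedges at $i$ is $\mathcal{A}_i=\{e\in E: e\cap U_i\ne\emptyset,\ e\nsubseteq U_i\}$. Compact decision diagram (DD). Each vertex $v_i$ has a binary variable $z_{v_i}\in\{0,1\}$. States are subsets of active hyperedges. The initial state is $s_0=\emptyset$, and assigning $z_{v_i}$ in state $s_{i-1}\subseteq\mathcal{A}_{i-1}$ leads to the state $$\phi_i(s_{i-1},z_{v_i})=\{e\in\mathcal{A}_i:\ (e\notin\mathcal{A}_{i-1}\text{ or }e\in s_{i-1})\text{ and }(v_i\notin e\text{ or }z_{v_i}=1)\}.$$ (Thus $s_i$ is the set of active hyperedges in $\mathcal{A}_i$ all of whose already-assigned vertices have value one; such hyperedges are called compatible.) The DD is the layered directed graph with layers $1,\ldots,n+1$ whose nodes in layer $i+1$ are the distinct states $s_i$ reachable from $s_0$ by some assignment of $z_{v_1},\ldots,z_{v_i}$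 (nodes with equal states are merged). These are called the reachable states after assigning $U_i$. Valid antichains. For $e\in\mathcal{A}_i$ the reduced active hyperedge is $\rho_i(e)=e\cap U_i$, and $\mathcal{R}_i=\{\rho_i(e):e\in\mathcal{A}_i\}$ is the set of distinct reduced active hyperedges, partially ordered by inclusion. An antichain $\mathcal{C}\subseteq\mathcal{R}_i$ is a (possibly empty) set of pairwise incomparable elements. Let $X(\mathcal{C})=\bigcup_{R\in\mathcal{C}}R$. The antichain $\mathcal{C}$ is valid if for every $R\in\mathcal{R}_i$ with $R\subseteq X(\mathcal{C})$ there exists $M\in\mathcal{C}$ with $R\subseteq M$. *)

(* Defs.v *)
From HB Require Import structures.
From mathcomp Require Import all_boot.

Set Implicit Arguments.
Unset Strict Implicit.
Unset Printing Implicit Defensive.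

(* A hypergraph is a finite vertex type V with a set E of hyperedges.  A vertex
   order (v_1, ..., v_n), n = #|V|, is a duplicate-free #|V|.-tuple sigma, so
   that tnth sigma k is the vertex v_(k+1) for k : 'I_#|V|. *)

Definition hypergraph_edges (V : finType) (E : {set {set V}}) : Prop :=
  forall e : {set V}, e \in E -> 2 <= #|e|.

(* U_i = {v_1, ..., v_i} *)
Definition assigned (V : finType) (sigma : #|V|.-tuple V) (i : nat) : {set V} :=
  [set v in take i sigma].

(* A_i *)
Definition active (V : finType) (E : {set {set V}}) (sigma : #|V|.-tuple V)
    (i : nat) : {set {set V}} :=
  [set e in E | (e :&: assigned sigma i != set0)
                && ~~ (e \subset assigned sigma i)].

(* phi_(k+1): the transition from s_k to s_(k+1) when z_(v_(k+1)) := b. *)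
Definition dd_step (V : finType) (E : {set {set V}}) (sigma : #|V|.-tuple V)
    (k : 'I_#|V|) (s : {set {set V}}) (b : bool) : {set {set V}} :=
  [set e in active E sigma k.+1 |
     ((e \notin active E sigma k) || (e \in s))
     && ((tnth sigma k \notin e) || b)].

(* The state s_i reached from s_0 = set0 under the assignment z; only the
   values of z at v_1, ..., v_i are used. *)
Definition dd_state (V : finType) (E : {set {set V}}) (sigma : #|V|.-tuple V)
    (z : {ffun V -> bool}) (i : nat) : {set {set V}} :=
  foldl (fun s k => dd_step E sigma k s (z (tnth sigma k)))
        set0 (take i (enum 'I_#|V|)).

Definition reachable_states (V : finType) (E : {set {set V}})
    (sigma : #|V|.-tuple V) (i : nat) : {set {set {set V}}} :=
  [set dd_state E sigma z i | z : {ffun V -> bool}].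

(* R_i *)
Definition reduced_active (V : finType) (E : {set {set V}})
    (sigma : #|V|.-tuple V) (i : nat) : {set {set V}} :=
  [set e :&: assigned sigma i | e in active E sigma i].

Definition antichain (V : finType) (P C : {set {set V}}) : bool :=
  (C \subset P)
  && [forall R in C, forall S in C, (R != S) ==> ~~ (R \subset S)].

(* For an antichain C of P, with X(C) = cover C. *)
Definition valid (V : finType) (P C : {set {set V}}) : bool :=
  [forall R in P, (R \subset cover C) ==> [exists M in C, R \subset M]].

Definition valid_antichains (V : finType) (P : {set {set V}}) :
    {set {set {set V}}} :=
  [set C | antichain P C && valid P C].

(* Main.v *)
Require Import Defs.
From mathcomp Require Import all_boot.

(** Why reachable states and valid antichains correspond.

    Unwinding the transitions, an active hyperedge [e] lies in the state
    reached under [z] exactly when [e :&: U_i] is contained in the set [Z] of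
    vertices given the value one (lemma [dd_stateE]).  So a state depends on
    [Z] only through the family [below P Z] of those reduced hyperedges, i.e.
    elements of [P = R_i], which are contained in [Z]; conversely the state
    determines that family, as the image of the state under [e |-> e :&: U_i].

    What remains is a fact about an arbitrary finite family [P] of sets: the
    subfamilies of the form [below P Z] are in bijection with the valid
    antichains.  Such a subfamily is sent to the antichain of its maximal
    elements, and an antichain [C] is sent back to [below P (cover C)].
    - Starting from [Z], every member of [below P Z] lies under a maximal one,
      and all maximal ones lie in [Z]; so replacing [Z] by the union of the
      maximal members changes nothing (lemma [below_cover_maxima]).
    - Starting from [C], validity says exactly that every member of
      [below P (cover C)] lies under a member of [C], so that no maximal
      element outside [C] appears, and the antichain property says that no
      member of [C] is lost (lemma [maxima_below_cover]). *)

Set Implicit Arguments.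
Unset Strict Implicit.
Unset Printing Implicit Defensive.

Section Families.

Variable V : finType.
Implicit Types (P D C : {set {set V}}) (Z R M : {set V}).

Definition below P Z : {set {set V}} := [set R in P | R \subset Z].

Definition maxima D : {set {set V}} := [set M | maxset (mem D) M].

Lemma maxima_sub D : maxima D \subset D.
Proof. by apply/subsetP=> M; rewrite inE => /maxsetp. Qed.

Lemma maxima_ge D R : R \in D -> exists2 M, M \in maxima D & R \subset M.
Proof.
move=> RD; have [M maxM RM] := @maxset_exists _ (mem D) R RD.
by exists M; rewrite ?inE.
Qed.

Lemma cover_maxima_below P Z : cover (maxima (below P Z)) \subset Z.
Proof.
apply/bigcupsP=> M /(subsetP (maxima_sub _)).
by rewrite inE => /andP[].
Qed.

Lemma below_cover_maxima P Z : below P (cover (maxima (below P Z))) = below P Z.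
Proof.
apply/setP=> R; rewrite !inE; apply: andb_id2l => RP; apply/idP/idP => [RX|RZ].
  exact: subset_trans RX (cover_maxima_below P Z).
have [M maxM RM] : exists2 M, M \in maxima (below P Z) & R \subset M.
  by apply: maxima_ge; rewrite inE RP.
exact: subset_trans RM (bigcup_sup M maxM).
Qed.

(** A member of [P] contained in the union of the maxima is contained in [Z],
    hence under one of the maxima: this is validity. *)
Lemma maxima_valid P Z : maxima (below P Z) \in valid_antichains P.
Proof.
rewrite inE; apply/andP; split; first (apply/andP; split).
- apply/subsetP=> M /(subsetP (maxima_sub _)).
  by rewrite inE => /andP[].
- apply/forall_inP=> R maxR; apply/forall_inP=> S maxS; apply/implyP.
  apply: contra => RS; move: maxR; rewrite inE => /maxsetP[_ maxR].
  by rewrite (maxR S) //; apply: (subsetP (maxima_sub _)).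
- apply/forall_inP=> R RP; apply/implyP=> RX.
  have [|M maxM RM] := @maxima_ge (below P Z) R.
    by rewrite inE RP; apply: subset_trans RX (cover_maxima_below P Z).
  by apply/exists_inP; exists M.
Qed.

Lemma antichain_eq P C R S :
  antichain P C -> R \in C -> S \in C -> R \subset S -> R = S.
Proof.
case/andP=> _ /forall_inP aC RC SC RS; apply/eqP.
by have /forall_inP/(_ S SC) := aC R RC; rewrite RS implybF negbK.
Qed.

Lemma maxima_below_cover P C :
  C \in valid_antichains P -> maxima (below P (cover C)) = C.
Proof.
rewrite inE => /andP[aC /forall_inP vC]; have /andP[/subsetP CP _] := aC.
have le_C R : R \in below P (cover C) -> exists2 M, M \in C & R \subset M.
  rewrite inE => /andP[RP RX].
  by have /implyP/(_ RX)/exists_inP[M] := vC R RP; exists M.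
have C_below M : M \in C -> M \in below P (cover C).
  by move=> MC; rewrite inE CP //=; apply: bigcup_sup.
apply/setP=> R; rewrite [LHS]inE; apply/maxsetP/idP => [[RD maxR]|RC].
  by have [M MC RM] := le_C R RD; rewrite -(maxR M) //; apply: C_below.
split=> [|S SD RS]; first exact: C_below.
(* S lies under some M of C, so R <= S <= M forces R = M by incomparability *)
have [M MC SM] := le_C S SD.
have RM := antichain_eq aC RC MC (subset_trans RS SM).
by apply/eqP; rewrite eqEsubset RS RM SM.
Qed.

End Families.

Section States.

Variables (V : finType) (E : {set {set V}}) (sigma : #|V|.-tuple V).
Implicit Types (z : {ffun V -> bool}) (Z : {set V}).

Lemma assignedS (k : 'I_#|V|) :
  assigned sigma k.+1 = tnth sigma k |: assigned sigma k.
Proof.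
apply/setP=> v; rewrite !inE (tnth_nth (tnth sigma k)).
by rewrite (take_nth (tnth sigma k)) ?size_tuple // mem_rcons inE.
Qed.

Lemma dd_stateS z (k : 'I_#|V|) :
  dd_state E sigma z k.+1 =
  dd_step E sigma k (dd_state E sigma z k) (z (tnth sigma k)).
Proof.
by rewrite /dd_state (take_nth k) ?size_enum_ord // foldl_rcons nth_ord_enum.
Qed.

(** The point is a hyperedge active at [i.+1] but not at [i]: not being
    contained in [U_(i.+1)], it can be inactive at [i] only because it misses
    [U_i].  It is then vacuously compatible at [i], which is why the transition
    may admit it regardless of the previous state. *)
Lemma dd_stateE z i : i <= #|V| ->
  dd_state E sigma z i =
  [set e in active E sigma i | e :&: assigned sigma i \subset [set v | z v]].
Proof.
elim: i => [_|i IHi lt_i].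
  have U0 : assigned sigma 0 = set0 by apply/setP=> v; rewrite !inE take0.
  by apply/setP=> e; rewrite !inE /dd_state take0 U0 setI0 eqxx inE andbF.
have /= -> := dd_stateS z (Ordinal lt_i).
rewrite IHi 1?ltnW //; apply/setP=> e.
rewrite [LHS]inE [RHS]inE; apply: andb_id2l => eA.
have /= defU := assignedS (Ordinal lt_i).
rewrite defU setIUr subUset andbC; congr (_ && _).
  have [ve|ve] := boolP (_ \in e).
    by rewrite (setIidPr _) sub1set ?inE.
  rewrite (_ : _ :&: _ = set0) ?sub0set //.
  by apply/setP=> v; rewrite !inE; case: eqP => [->|_];
     rewrite ?(negPf ve) ?andbF.
rewrite [e \in _ in X in _ || X]inE; case: (boolP (e \in active E sigma i)) => //=.
move: eA; rewrite !inE => /and3P[-> _ neU]; rewrite /= negb_and !negbK.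
case/orP=> [/eqP->|eU]; first by rewrite sub0set.
by case/negP: neU; rewrite defU; apply: subset_trans eU (subsetUr _ _).
Qed.

Definition compatible i Z : {set {set V}} :=
  [set e in active E sigma i | e :&: assigned sigma i \subset Z].

Lemma reachable_statesE i : i <= #|V| ->
  reachable_states E sigma i = [set compatible i Z | Z : {set V}].
Proof.
move=> le_i; apply/setP=> s; apply/imsetP/imsetP => [[z _ ->]|[Z _ ->]].
  by exists [set v | z v]; rewrite // dd_stateE.
exists [ffun v => v \in Z] => //; rewrite dd_stateE //; congr compatible.
by apply/setP=> v; rewrite inE ffunE.
Qed.

Lemma reduced_compatible i Z :
  [set e :&: assigned sigma i | e in compatible i Z] =
  below (reduced_active E sigma i) Z.
Proof.
apply/setP=> R; rewrite inE; apply/imsetP/andP => [[e]|[/imsetP[e eA ->] eZ]].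
  by rewrite inE => /andP[eA eZ] ->; split; first exact: imset_f.
by exists e; rewrite // inE eA.
Qed.

Lemma compatible_preim i Z :
  compatible i Z =
  [set e in active E sigma i |
     e :&: assigned sigma i \in below (reduced_active E sigma i) Z].
Proof.
apply/setP=> e; rewrite [LHS]inE [RHS]inE; apply: andb_id2l => eA.
by rewrite inE (imset_f (fun e => e :&: assigned sigma i) eA).
Qed.

Definition antichain_of_state i (s : {set {set V}}) : {set {set V}} :=
  maxima [set e :&: assigned sigma i | e in s].

Lemma antichain_of_state_valid i s : i <= #|V| ->
  s \in reachable_states E sigma i ->
  antichain_of_state i s \in valid_antichains (reduced_active E sigma i).
Proof.
move=> le_i; rewrite reachable_statesE // => /imsetP[Z _ ->].
by rewrite /antichain_of_state reduced_compatible maxima_valid.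
Qed.

Lemma compatible_reachable i Z : i <= #|V| ->
  compatible i Z \in reachable_states E sigma i.
Proof. by move=> le_i; rewrite reachable_statesE // imset_f. Qed.

Lemma antichain_of_stateK i s : i <= #|V| ->
  s \in reachable_states E sigma i ->
  compatible i (cover (antichain_of_state i s)) = s.
Proof.
move=> le_i; rewrite reachable_statesE // => /imsetP[Z _ ->].
rewrite /antichain_of_state reduced_compatible compatible_preim.
by rewrite below_cover_maxima -compatible_preim.
Qed.

Lemma compatible_coverK i C :
  C \in valid_antichains (reduced_active E sigma i) ->
  antichain_of_state i (compatible i (cover C)) = C.
Proof.
by move=> vC; rewrite /antichain_of_state reduced_compatible maxima_below_cover.
Qed.

End States.

Theorem lemma1 (V : finType) (E : {set {set V}})
    (hE : hypergraph_edges E)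
    (sigma : #|V|.-tuple V) (hsigma : uniq sigma)
    (i : nat) (hi : 1 <= i <= #|V|) :
  exists f : {s : {set {set V}} | s \in reachable_states E sigma i} ->
             {C : {set {set V}} |
               C \in valid_antichains (reduced_active E sigma i)},
    bijective f.
Proof.
have /andP[_ le_i] := hi.
pose VA := valid_antichains (reduced_active E sigma i).
exists (fun s => exist (fun C => C \in VA) _
                       (antichain_of_state_valid le_i (svalP s))).
exists (fun C => exist (fun s => s \in reachable_states E sigma i) _
                       (compatible_reachable E sigma (cover (sval C)) le_i)).
- by move=> s; apply: val_inj; apply: antichain_of_stateK (svalP s).
- by move=> C; apply: val_inj; apply: compatible_coverK (svalP C).
Qed.
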